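(* For any $d\in\mathbb{R}$, any real $x\ge0$ and $\alpha\in[0,1]$ with $x+\alpha>-d$, and any $c\in[0,1]$, we have $$\frac{\widehat{\Pi}(x,\alpha)}{S_d(x+\alpha)} = \exp\left(\int_1^{\infty}\frac{\phi_\alpha(t)}{x+t}\,dt+\int_{1/2}^{\infty}\frac{\frac12-\{t\}}{x+\alpha+t}\,dt+\int_{1/2}^{d}\frac{t-\frac12}{x+\alpha+t}\,dt\right)$$ $$= \exp\left(\int_1^{\infty}\frac{\phi_\alpha(t)}{x+t}\,dt+\int_{d}^{\infty}\frac{\frac12-\{t\}}{x+\alpha+t}\,dt+\int_{c}^{d}\frac{\lfloor t\rfloor}{x+\alpha+t}\,dt\right),$$ which for $d\in[0,1]$ and real $x\ge0$, $\alpha\in[0,1]$ with $x+\alpha>-d$ simplifies to $$\frac{\widehat{\Pi}(x,\alpha)}{S_d(x+\alpha)} = \exp\left(\int_1^{\infty}\frac{\phi_\alpha(t)}{x+t}\,dt+\int_{d}^{\infty}\frac{\frac12-\{t\}}{x+\alpha+t}\,dt\right).$$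
   Context: $\Pi(x) := \Gamma(x+1)$ for real $x\ge 0$, with $\Gamma$ Euler's gamma function. For $x\ge0$ and $\alpha\in[0,1]$, $\widehat{\Pi}(x,\alpha) := \Pi(x)^{1-\alpha}\,\Pi(x+1)^{\alpha}=\Pi(x)(x+1)^\alpha$. For $d\in\mathbb{R}$ and real $x>-d$, $S_d(x) := \sqrt{2\pi}\,e^{-d}\,(x+d)^{x+\frac12}\,e^{-x}$. For $t\in\mathbb{R}$, $\lfloor t\rfloor$ is the floor and $\{t\}:=t-\lfloor t\rfloor\in[0,1)$ the fractional part. For $\alpha\in[0,1]$, $\phi_\alpha:\mathbb{R}\to\mathbb{R}$ is defined by $\phi_\alpha(t)=1-\alpha$ if $\{t\}\le\alpha$ and $\phi_\alpha(t)=-\alpha$ if $\{t\}>\alpha$. Integrals over bounded intervals are oriented, $\int_a^b=-\int_b^a$, and the value of an integrand at a single point is irrelevant. Integrals over unbounded intervals are improper integrals, $\int_a^\infty f(t)\,dt=\lim_{T\to\infty}\int_a^T f(t)\,dt$ (existence of the limit being part of the assertion). *)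

(* Defs.v *)
(* Stdlib world: concrete reals with Coquelicot's Riemann integrals. *)
From Stdlib Require Import Reals.
From Coquelicot Require Import Coquelicot.
Open Scope R_scope.

(* Euler's integral; meaningful for x > 0. *)
Definition Gamma (x : R) : R :=
  RInt_gen (fun t => Rpower t (x - 1) * exp (- t))
    (at_right 0) (Rbar_locally p_infty).

Definition Pi_fun (x : R) : R := Gamma (x + 1).

Definition Pi_hat (x alpha : R) : R :=
  Rpower (Pi_fun x) (1 - alpha) * Rpower (Pi_fun (x + 1)) alpha.

(* Meaningful for x > - d, where the base x + d of the real power is positive. *)
Definition S_shift (d x : R) : R :=
  sqrt (2 * PI) * exp (- d) * Rpower (x + d) (x + 1 / 2) * exp (- x).

Definition floor_R (t : R) : R := IZR (Int_part t).

(* frac_part t is t - floor_R t. *)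
Definition phi (alpha t : R) : R :=
  if Rle_dec (frac_part t) alpha then 1 - alpha else - alpha.

(* The limit of the integrals of f over [a, T] as T tends to infinity.  The
   value RInt_to_infty f a is junk unless ex_RInt_to_infty f a holds. *)
Definition ex_RInt_to_infty (f : R -> R) (a : R) : Prop :=
  ex_RInt_gen f (at_point a) (Rbar_locally p_infty).

Definition RInt_to_infty (f : R -> R) (a : R) : R :=
  RInt_gen f (at_point a) (Rbar_locally p_infty).

Definition phi_integrand (x alpha t : R) : R := phi alpha t / (x + t).

Definition saw_integrand (x alpha t : R) : R :=
  (1 / 2 - frac_part t) / (x + alpha + t).

Definition shift_integrand (x alpha t : R) : R :=
  (t - 1 / 2) / (x + alpha + t).

Definition floor_integrand (x alpha t : R) : R :=
  floor_R t / (x + alpha + t).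

(* Main.v *)
Require Import Defs.
From Stdlib Require Import Reals Lra Lia.
From Coquelicot Require Import Coquelicot.
Open Scope R_scope.

(** Write [lnPi] for the logarithm of the interpolated factorial and
    [y = x + alpha].  The first equality holds because each of the three integrals
    has a closed form:
    - the integral of [phi alpha t / (x + t)] from 1 to infinity is
      [lnPi x - lnPi y + alpha * ln (x + 1)];
    - the integral of [(1/2 - frac t) / (y + t)] from 1/2 to infinity is
      [lnPi y + y + 1/2 - (y + 1/2) * ln (y + 1/2) - ln (2 * PI) / 2];
    - the integral of [(t - 1/2) / (y + t)] from 1/2 to [d] is elementary.
    Their sum is the logarithm of the quotient ([Pi_hat_ratio]).

    On a unit interval between integers the first two integrands are elementary,
    and by the functional equation [Pi (s + 1) = (s + 1) Pi s] the sums of the block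
    integrals telescope ([is_RInt_phi_integrand], [is_RInt_saw_integrand]).  What is
    left at the moving end is a remainder whose limit has to be known.  For [phi]
    it is the logarithm of [Pi (s + alpha) / (Pi s * (s + 1)^alpha)] at [s = x + n],
    which tends to 0 by Wendel's inequality ([Pi_fun_wendel]); that inequality is
    the concavity of [t^alpha] integrated against [t^s e^(-t)].  For the sawtooth
    it is the logarithm of [Pi z / (z^(z + 1/2) e^(-z))] at [z = y + n], which
    tends to [ln (2 * PI) / 2] by Stirling's formula ([stirling]).  Stirling's
    formula holds at the natural numbers because that quantity decreases and is
    bounded below, with the limit identified through Wallis' product
    ([wallis_log_bounds]); Wendel's inequality carries it over to translates of the
    natural numbers.  A limit along the natural numbers suffices for the improper
    integrals, as the integrands are O(1/t) ([is_RInt_to_infty_of_nat]).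

    The second equality is [(1/2 - frac t) + (t - 1/2) = floor t], which turns the
    bounded integral into one of the floor when the sawtooth integral is made to
    start at [d]; the floor vanishes on [[0, 1)], whence the free choice of [c].  For
    [d] in the unit interval, [c = d] gives the last formula. *)

(** * Euler's integral *)

Lemma exp_le_compat (x y : R) : x <= y -> exp x <= exp y.
Proof.
intros [H | ->]; [now apply Rlt_le, exp_increasing | apply Rle_refl].
Qed.

Lemma ball_real_bounds (x : R) (e : posreal) (y : R) :
  ball x e y -> x - e < y < x + e.
Proof. intros H; exact (proj1 (Rabs_lt_between' y x e) H). Qed.

Definition euler_integrand (s t : R) : R := Rpower t s * exp (- t).

Lemma euler_integrand_pos (s t : R) : 0 < euler_integrand s t.
Proof. apply Rmult_lt_0_compat; apply exp_pos. Qed.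

Lemma euler_integrand_continuous (s t : R) :
  0 < t -> continuous (euler_integrand s) t.
Proof.
intros Ht.
apply (ex_derive_continuous (V := R_NormedModule)).
unfold euler_integrand, Rpower; auto_derive; lra.
Qed.

Lemma euler_integrand_ex_RInt (s a b : R) :
  0 < a -> 0 < b -> ex_RInt (euler_integrand s) a b.
Proof.
intros Ha Hb; apply (ex_RInt_continuous (V := R_CompleteNormedModule)).
intros t Ht; apply euler_integrand_continuous.
apply Rlt_le_trans with (Rmin a b); [now apply Rmin_glb_lt | apply Ht].
Qed.

(** Any constant that makes [euler_integrand_le] true would do; this one comes from
    the tangent line of [ln] at [2 * (s + 1)]. *)
Definition growth_const (s : R) : R := exp (s * ln (2 * (s + 1))).

(** Half of the exponential decay absorbs the power: [ln u <= u] at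
    [u = t / (2 * (s + 1))] gives [s * ln t <= t / 2 + s * ln (2 * (s + 1))].  This
    bounds all partial integrals and makes the integrand vanish at infinity. *)
Lemma euler_integrand_le (s t : R) :
  0 <= s -> 0 < t -> euler_integrand s t <= growth_const s * exp (- (t / 2)).
Proof.
intros Hs Ht; unfold euler_integrand, growth_const, Rpower.
rewrite <- !exp_plus; apply exp_le_compat.
assert (Hln : ln t <= t / (2 * (s + 1)) + ln (2 * (s + 1))).
{ set (u := t / (2 * (s + 1))).
  assert (Hu : 0 < u) by (apply Rdiv_lt_0_compat; lra).
  replace t with (u * (2 * (s + 1))) at 1 by (unfold u; field; lra).
  rewrite ln_mult by lra.
  generalize (exp_ineq1_le (ln u)); rewrite exp_ln by lra; lra. }
assert (Hst : s * (t / (2 * (s + 1))) <= t / 2).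
{ apply Rmult_le_reg_r with (2 * (s + 1)); [lra|].
  field_simplify; [nra | lra]. }
generalize (Rmult_le_compat_l s _ _ Hs Hln); lra.
Qed.

Lemma is_RInt_exp_half (K a b : R) :
  is_RInt (fun t => K * exp (- (t / 2))) a b
    (2 * K * (exp (- (a / 2)) - exp (- (b / 2)))).
Proof.
replace (2 * K * (exp (- (a / 2)) - exp (- (b / 2)))) with
  (minus (- 2 * K * exp (- (b / 2))) (- 2 * K * exp (- (a / 2))))
  by (unfold minus, plus, opp; simpl; ring).
apply (is_RInt_derive (V := R_CompleteNormedModule)
  (fun t => - 2 * K * exp (- (t / 2))) (fun t => K * exp (- (t / 2)))).
- intros t _; auto_derive; [easy | unfold Rdiv; field].
- intros t _; apply (ex_derive_continuous (V := R_NormedModule)).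
  auto_derive; easy.
Qed.

(** For a nonnegative integrand the partial integrals grow as the interval
    grows, so that their supremum is the improper integral, and it dominates each
    of them. *)
Lemma ex_RInt_gen_nonneg (f : R -> R) (M : R) :
  (forall t, 0 < t -> 0 <= f t) ->
  (forall a b, 0 < a -> 0 < b -> ex_RInt f a b) ->
  (forall a b, 0 < a <= b -> RInt f a b <= M) ->
  exists l, is_RInt_gen f (at_right 0) (Rbar_locally p_infty) l /\
    (forall a b, 0 < a <= b -> RInt f a b <= l).
Proof.
intros Hpos Hex HM.
set (E := fun r => exists a b, 0 < a <= b /\ r = RInt f a b).
destruct (completeness E) as [l [Hub Hlub]].
{ exists M; intros r (a & b & Hab & ->); now apply HM. }
{ exists (RInt f 1 1), 1, 1; split; [lra | easy]. }
assert (Hle : forall a b, 0 < a <= b -> RInt f a b <= l).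
{ intros a b Hab; apply Hub; now exists a, b. }
exists l; split; [| exact Hle].
intros P [eps HP].
destruct (Classical_Prop.classic
  (exists a b, 0 < a <= b /\ l - eps < RInt f a b)) as [H | H].
2:{ exfalso; assert (l <= l - eps); [| generalize (cond_pos eps); lra].
    apply Hlub; intros r (a & b & Hab & ->).
    apply Rnot_lt_le; intros Hlt; apply H; now exists a, b. }
destruct H as (a0 & b0 & Hab0 & Hl).
apply Filter_prod with (fun a => 0 < a < a0) (fun b => b0 < b).
- assert (Ha0 : 0 < a0) by lra.
  exists (mkposreal a0 Ha0); intros a Ha Ha'; split; [easy |].
  apply ball_real_bounds in Ha; simpl in Ha; lra.
- now exists b0.
- intros a b Ha Hb; simpl.
  exists (RInt f a b); split.
  + apply (RInt_correct (V := R_CompleteNormedModule)), Hex; lra.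
  + apply HP.
    assert (Hab : RInt f a b <= l) by (apply Hle; lra).
    assert (Hge : RInt f a0 b0 <= RInt f a b).
    { rewrite <- (RInt_Chasles (V := R_CompleteNormedModule) f a a0 b)
        by (apply Hex; lra).
      rewrite <- (RInt_Chasles (V := R_CompleteNormedModule) f a0 b0 b)
        by (apply Hex; lra).
      unfold plus; simpl.
      assert (0 <= RInt f a a0).
      { apply RInt_ge_0; [lra | apply Hex; lra |]; intros; apply Hpos; lra. }
      assert (0 <= RInt f b0 b).
      { apply RInt_ge_0; [lra | apply Hex; lra |]; intros; apply Hpos; lra. }
      lra. }
    unfold ball; simpl; unfold AbsRing_ball, abs, minus, plus, opp; simpl.
    apply Rabs_def1; lra.
Qed.

Lemma Pi_fun_spec (s : R) :
  0 <= s ->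
  is_RInt_gen (euler_integrand s) (at_right 0) (Rbar_locally p_infty) (Pi_fun s)
  /\ (forall a b, 0 < a <= b -> RInt (euler_integrand s) a b <= Pi_fun s).
Proof.
intros Hs.
destruct (ex_RInt_gen_nonneg (euler_integrand s) (2 * growth_const s))
  as (l & Hl & Hle).
- intros t _; apply Rlt_le, euler_integrand_pos.
- apply euler_integrand_ex_RInt.
- intros a b Hab.
  assert (HK : 0 < growth_const s) by apply exp_pos.
  apply Rle_trans with (RInt (fun t => growth_const s * exp (- (t / 2))) a b).
  + apply RInt_le; [lra | apply euler_integrand_ex_RInt; lra | |].
    * eexists; apply is_RInt_exp_half.
    * intros t Ht; apply euler_integrand_le; lra.
  + rewrite (is_RInt_unique (V := R_CompleteNormedModule) _ _ _ _
      (is_RInt_exp_half _ _ _)).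
    assert (exp (- (a / 2)) <= 1)
      by (rewrite <- exp_0; apply exp_le_compat; lra).
    generalize (exp_pos (- (b / 2))); nra.
- enough (Pi_fun s = l) as -> by easy.
  unfold Pi_fun, Gamma.
  apply (is_RInt_gen_unique (V := R_CompleteNormedModule)).
  apply is_RInt_gen_ext with (2 := Hl).
  apply filter_forall; intros ab t _; unfold euler_integrand.
  now replace (s + 1 - 1) with s by ring.
Qed.

Lemma Pi_fun_pos (s : R) : 0 <= s -> 0 < Pi_fun s.
Proof.
intros Hs; apply Rlt_le_trans with (RInt (euler_integrand s) 1 2).
- apply RInt_gt_0; [lra | intros; apply euler_integrand_pos |].
  intros; apply euler_integrand_continuous; lra.
- apply (Pi_fun_spec s Hs); lra.
Qed.

Lemma exp_neg_half_lim : filterlim (fun t => exp (- (t / 2)))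
  (Rbar_locally p_infty) (locally 0).
Proof.
apply filterlim_comp with (G := Rbar_locally m_infty) (g := exp).
- intros P [M HM]; exists (- 2 * M); intros t Ht; apply HM; lra.
- exact is_lim_exp_m.
Qed.

(** The fundamental theorem of calculus on the open half-line, where the
    antiderivative is only controlled through its limits at both ends. *)
Lemma is_RInt_gen_derive_pos (F f : R -> R) (l0 l1 : R) :
  (forall t, 0 < t -> is_derive F t (f t)) ->
  (forall t, 0 < t -> continuous f t) ->
  filterlim F (at_right 0) (locally l0) ->
  filterlim F (Rbar_locally p_infty) (locally l1) ->
  is_RInt_gen f (at_right 0) (Rbar_locally p_infty) (l1 - l0).
Proof.
intros HF Hf H0 H1.
assert (Hpos : filter_prod (at_right 0) (Rbar_locally p_infty)
  (fun ab => forall t, Rmin (fst ab) (snd ab) <= t -> 0 < t)).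
{ apply Filter_prod with (fun a => 0 < a) (fun b => 0 < b).
  - now exists (mkposreal 1 Rlt_0_1).
  - now exists 0.
  - intros a b Ha Hb t Ht; simpl in Ht.
    apply Rlt_le_trans with (2 := Ht); now apply Rmin_glb_lt. }
assert (HD : forall t, 0 < t -> Derive F t = f t)
  by (intros t Ht; now apply is_derive_unique, HF).
apply is_RInt_gen_ext with (f := Derive F).
{ apply filter_imp with (2 := Hpos); intros ab H t Ht; apply HD, H; lra. }
apply is_RInt_gen_Derive; try assumption.
- apply filter_imp with (2 := Hpos); intros ab H t Ht.
  exists (f t); apply HF, H; lra.
- apply filter_imp with (2 := Hpos); intros ab H t Ht.
  assert (0 < t) as H2 by (apply H; lra).
  apply continuous_ext_loc with f; [| now apply Hf].
  exists (mkposreal t H2); intros u Hu; symmetry; apply HD.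
  apply ball_real_bounds in Hu; simpl in Hu; lra.
Qed.

(** Integration by parts: [(s + 1) t^s e^(-t) - t^(s+1) e^(-t)] is the derivative of
    [t^(s+1) e^(-t)], which vanishes at both ends of the half-line. *)
Lemma Pi_fun_succ (s : R) : 0 <= s -> Pi_fun (s + 1) = (s + 1) * Pi_fun s.
Proof.
intros Hs.
assert (H1 : is_RInt_gen (fun t => minus (scal (s + 1) (euler_integrand s t))
    (euler_integrand (s + 1) t)) (at_right 0) (Rbar_locally p_infty) (0 - 0)).
{ apply (is_RInt_gen_derive_pos (euler_integrand (s + 1))).
  - intros t Ht.
    unfold euler_integrand, Rpower; auto_derive; [easy |].
    replace (exp ((s + 1) * ln t)) with (t * exp (s * ln t))
      by (rewrite <- (exp_ln t) at 1 by easy; rewrite <- exp_plus; f_equal; ring).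
    unfold minus, plus, opp, scal; simpl; unfold mult; simpl; field; lra.
  - intros t Ht; apply (continuous_minus (V := R_NormedModule)).
    + apply (continuous_scal_r (V := R_NormedModule)).
      now apply euler_integrand_continuous.
    + now apply euler_integrand_continuous.
  - apply (filterlim_le_le (F := at_right 0)) with (l := Finite 0)
      (f := fun _ => 0) (h := fun t => t).
    + exists (mkposreal 1 Rlt_0_1); intros t Hb Ht.
      split; [apply Rlt_le, euler_integrand_pos |].
      apply ball_real_bounds in Hb; simpl in Hb.
      unfold euler_integrand, Rpower; rewrite <- exp_plus.
      rewrite <- (exp_ln t) at 3 by easy.
      apply exp_le_compat.
      (* Near 0 the integrand lies below [t], because [t^(s+1) <= t] for [t < 1]. *)
      assert (ln t <= 0) by (rewrite <- ln_1; apply ln_le; lra).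
      nra.
    + apply filterlim_const.
    + intros P [e He]; exists e; intros t Ht _; now apply He.
  - apply (filterlim_le_le (F := Rbar_locally p_infty)) with (l := Finite 0)
      (f := fun _ => 0) (h := fun t => growth_const (s + 1) * exp (- (t / 2))).
    + exists 0; intros t Ht; split; [apply Rlt_le, euler_integrand_pos |].
      apply euler_integrand_le; lra.
    + apply filterlim_const.
    + replace 0 with (growth_const (s + 1) * 0) by ring.
      apply filterlim_comp with (1 := exp_neg_half_lim).
      apply (filterlim_scal_r (V := R_NormedModule) (growth_const (s + 1)) 0). }
assert (H2 := is_RInt_gen_minus _ _ _ _
  (is_RInt_gen_scal _ (s + 1) _ (proj1 (Pi_fun_spec s Hs)))
  (proj1 (Pi_fun_spec (s + 1) ltac:(lra)))).
apply (is_RInt_gen_unique (V := R_CompleteNormedModule)) in H1, H2.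
assert (H3 := eq_trans (eq_sym H1) H2).
unfold minus, plus, opp, scal in H3; simpl in H3; unfold mult in H3; simpl in H3.
lra.
Qed.

Lemma Pi_fun_0 : Pi_fun 0 = 1.
Proof.
assert (H1 : is_RInt_gen (euler_integrand 0) (at_right 0)
  (Rbar_locally p_infty) (0 - -1)).
{ apply (is_RInt_gen_derive_pos (fun t => - exp (- t))).
  - intros t Ht; unfold euler_integrand, Rpower; auto_derive; [easy |].
    rewrite Rmult_0_l, exp_0; ring.
  - intros t Ht; now apply euler_integrand_continuous.
  - intros P HP.
    assert (Hc : continuous (fun t => - exp (- t)) 0).
    { apply (ex_derive_continuous (V := R_NormedModule)); auto_derive; easy. }
    assert (H := Hc P).
    destruct H as [e He].
    { now replace (- exp (- 0)) with (-1) by (rewrite Ropp_0, exp_0; ring). }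
    exists e; intros t Ht _; now apply He.
  - replace 0 with (- 0) by ring.
    apply filterlim_comp with (g := fun y => - y) (G := locally 0).
    2: apply (filterlim_opp (V := R_NormedModule) 0).
    apply filterlim_comp with (G := Rbar_locally m_infty) (g := exp).
    + intros P [M HM]; exists (- M); intros t Ht; apply HM; lra.
    + exact is_lim_exp_m. }
assert (H2 := proj1 (Pi_fun_spec 0 (Rle_refl 0))).
apply (is_RInt_gen_unique (V := R_CompleteNormedModule)) in H1, H2.
assert (H3 := eq_trans (eq_sym H1) H2); lra.
Qed.

(** Convexity of [exp] between [0] and [v], from the two tangent inequalities at
    [l * v]: one bounds [exp v] and the other [exp 0 = 1] from below. *)
Lemma exp_weighted_am_gm (l v : R) : 0 <= l <= 1 ->
  exp (l * v) <= 1 - l + l * exp v.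
Proof.
intros Hl.
assert (H1 : exp v = exp (l * v) * exp ((1 - l) * v))
  by (rewrite <- exp_plus; f_equal; ring).
assert (H2 : 1 = exp (l * v) * exp (- (l * v)))
  by (rewrite <- exp_plus, <- exp_0; f_equal; ring).
generalize (exp_ineq1_le ((1 - l) * v)), (exp_ineq1_le (- (l * v))),
  (exp_pos (l * v)).
set (A := exp (l * v)) in *; set (B := exp ((1 - l) * v)) in *.
set (C := exp (- (l * v))) in *; intros HB HC HA.
assert (A * (1 + - (l * v)) <= 1) by nra.
assert (A * (1 + (1 - l) * v) <= exp v) by (rewrite H1; nra).
nra.
Qed.

(** Wendel's inequality.  The concave function [t^l] lies below its tangent line at
    [t = s + 1]; integrated against [t^s e^(-t)], the tangent line gives
    [(s + 1)^l ((1 - l) Pi s + l / (s + 1) Pi (s + 1))], where both terms are multiples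
    of [Pi s] by the functional equation. *)
Lemma Pi_fun_wendel (s l : R) : 0 <= s -> 0 <= l <= 1 ->
  Pi_fun (s + l) <= Rpower (s + 1) l * Pi_fun s.
Proof.
intros Hs Hl.
assert (H : is_RInt_gen (fun t =>
    plus (scal (Rpower (s + 1) l * (1 - l)) (euler_integrand s t))
         (scal (Rpower (s + 1) l * l / (s + 1)) (euler_integrand (s + 1) t)))
    (at_right 0) (Rbar_locally p_infty)
    (plus (scal (Rpower (s + 1) l * (1 - l)) (Pi_fun s))
          (scal (Rpower (s + 1) l * l / (s + 1)) (Pi_fun (s + 1))))).
{ apply (is_RInt_gen_plus (V := R_NormedModule));
    apply (is_RInt_gen_scal (V := R_NormedModule)); apply Pi_fun_spec; lra. }
assert (Hle := fun h1 h2 h3 => RInt_gen_norm (V := R_CompleteNormedModule)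
  (Fa := at_right 0) (Fb := Rbar_locally p_infty)
  (euler_integrand (s + l)) _ (Pi_fun (s + l)) _ h1 h2 h3 H).
replace (Rpower (s + 1) l * Pi_fun s) with
  (plus (scal (Rpower (s + 1) l * (1 - l)) (Pi_fun s))
        (scal (Rpower (s + 1) l * l / (s + 1)) (Pi_fun (s + 1)))).
2:{ rewrite (Pi_fun_succ s Hs).
    unfold plus, scal; simpl; unfold mult; simpl; field; lra. }
apply Rle_trans with (1 := Rle_abs _); apply Hle.
- apply Filter_prod with (fun a => a < 1) (fun b => 1 < b).
  + exists (mkposreal 1 Rlt_0_1); intros t Ht _.
    apply ball_real_bounds in Ht; simpl in Ht; lra.
  + now exists 1.
  + intros a b Ha Hb; simpl; lra.
- apply Filter_prod with (fun a => 0 < a) (fun b => True).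
  + now exists (mkposreal 1 Rlt_0_1).
  + now exists 0.
  + intros a b Ha _ t Ht; simpl in Ht.
    assert (Ht0 : 0 < t) by lra.
    change (Rabs (euler_integrand (s + l) t) <=
      Rpower (s + 1) l * (1 - l) * euler_integrand s t
      + Rpower (s + 1) l * l / (s + 1) * euler_integrand (s + 1) t).
    rewrite Rabs_pos_eq by apply Rlt_le, euler_integrand_pos.
    assert (E1 : forall r, euler_integrand (s + r) t
      = euler_integrand s t * Rpower t r).
    { intros r; unfold euler_integrand; rewrite Rpower_plus; ring. }
    rewrite !E1, Rpower_1 by easy.
    assert (E2 : Rpower t l <= Rpower (s + 1) l * (1 - l + l * (t / (s + 1)))).
    { assert (Ht' : t = (s + 1) * (t / (s + 1))) by (field; lra).
      assert (Hu : 0 < t / (s + 1)) by (apply Rdiv_lt_0_compat; lra).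
      rewrite Ht' at 1; rewrite <- Rpower_mult_distr by lra.
      apply Rmult_le_compat_l; [apply Rlt_le, exp_pos |].
      rewrite <- (exp_ln (t / (s + 1))) at 2 by easy.
      now apply exp_weighted_am_gm. }
    generalize (Rmult_le_compat_l _ _ _ (Rlt_le _ _ (euler_integrand_pos s t)) E2).
    intros E3; eapply Rle_trans; [exact E3 |]; apply Req_le; field; lra.
- apply Pi_fun_spec; lra.
Qed.

Definition lnPi (s : R) : R := ln (Pi_fun s).

Lemma lnPi_succ (s : R) : 0 <= s -> lnPi (s + 1) = ln (s + 1) + lnPi s.
Proof.
intros Hs; unfold lnPi; rewrite Pi_fun_succ by easy.
apply ln_mult; [lra | now apply Pi_fun_pos].
Qed.

Lemma lnPi_wendel_upper (s l : R) : 0 <= s -> 0 <= l <= 1 ->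
  lnPi (s + l) <= lnPi s + l * ln (s + 1).
Proof.
intros Hs Hl; unfold lnPi.
replace (ln (Pi_fun s) + l * ln (s + 1))
  with (ln (Rpower (s + 1) l * Pi_fun s)).
- apply ln_le; [apply Pi_fun_pos; lra | now apply Pi_fun_wendel].
- rewrite ln_mult; [| apply exp_pos | now apply Pi_fun_pos].
  unfold Rpower; rewrite ln_exp; ring.
Qed.

(** The upper bound applied from [s + l] to [s + 1], a step of length [1 - l]. *)
Lemma lnPi_wendel_lower (s l : R) : 0 <= s -> 0 <= l <= 1 ->
  lnPi s + ln (s + 1) - (1 - l) * ln (s + l + 1) <= lnPi (s + l).
Proof.
intros Hs Hl.
assert (H := lnPi_wendel_upper (s + l) (1 - l) ltac:(lra) ltac:(lra)).
replace (s + l + (1 - l)) with (s + 1) in H by ring.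
rewrite lnPi_succ in H by easy; lra.
Qed.

(** * Wallis' product, in logarithmic form *)

Definition sin_pow_integral (n : nat) : R := RInt (fun t => sin t ^ n) 0 (PI / 2).

Lemma sin_pow_ex_RInt (n : nat) (a b : R) : ex_RInt (fun t => sin t ^ n) a b.
Proof.
apply (ex_RInt_continuous (V := R_CompleteNormedModule)); intros t _.
apply (ex_derive_continuous (V := R_NormedModule)); auto_derive; easy.
Qed.

(** The difference of the two integrands is the derivative of
    [- cos t * sin t ^ (n + 1)], which is 0 at both ends. *)
Lemma sin_pow_integral_rec (n : nat) :
  INR (S (S n)) * sin_pow_integral (S (S n)) = INR (S n) * sin_pow_integral n.
Proof.
assert (H : is_RInt (fun t => minus (scal (INR (S (S n))) (sin t ^ S (S n)))
    (scal (INR (S n)) (sin t ^ n))) 0 (PI / 2)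
  (minus (- (cos (PI / 2) * sin (PI / 2) ^ S n)) (- (cos 0 * sin 0 ^ S n)))).
{ apply (is_RInt_derive (V := R_CompleteNormedModule)
    (fun t => - (cos t * sin t ^ S n))).
  - intros t _; auto_derive; [easy |].
    change (minus (scal (INR (S (S n))) (sin t ^ S (S n)))
      (scal (INR (S n)) (sin t ^ n)))
      with (INR (S (S n)) * sin t ^ S (S n) - INR (S n) * sin t ^ n).
    rewrite !S_INR; simpl Nat.pred; simpl pow.
    assert (Hsc : sin t * sin t = 1 - cos t * cos t)
      by (generalize (sin2_cos2 t); unfold Rsqr; lra).
    change (match n with O => 1 | S _ => INR n + 1 end) with (INR (S n)).
    rewrite S_INR; ring [Hsc].
  - intros t _; apply (ex_derive_continuous (V := R_NormedModule)).
    unfold minus, plus, opp, scal; simpl; unfold mult; simpl.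
    auto_derive; easy. }
assert (H' := is_RInt_minus (V := R_NormedModule) _ _ _ _ _ _
  (is_RInt_scal (V := R_NormedModule) _ _ _ (INR (S (S n))) _
    (RInt_correct (V := R_CompleteNormedModule) _ _ _
      (sin_pow_ex_RInt (S (S n)) 0 (PI / 2))))
  (is_RInt_scal (V := R_NormedModule) _ _ _ (INR (S n)) _
    (RInt_correct (V := R_CompleteNormedModule) _ _ _
      (sin_pow_ex_RInt n 0 (PI / 2))))).
apply (is_RInt_unique (V := R_CompleteNormedModule)) in H, H'.
assert (H2 := eq_trans (eq_sym H) H').
change (- (cos (PI / 2) * sin (PI / 2) ^ S n) - - (cos 0 * sin 0 ^ S n)
  = INR (S (S n)) * sin_pow_integral (S (S n))
    - INR (S n) * sin_pow_integral n) in H2.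
rewrite cos_PI2, sin_0, pow_i in H2 by lia; lra.
Qed.

Lemma sin_pow_integral_decr (n : nat) :
  sin_pow_integral (S n) <= sin_pow_integral n.
Proof.
apply RInt_le; try apply sin_pow_ex_RInt; [generalize PI_RGT_0; lra |].
intros t Ht; generalize (SIN_bound t); intros Hb; simpl.
assert (0 <= sin t) by (apply sin_ge_0; generalize PI_RGT_0; lra).
generalize (pow_le (sin t) n H); nra.
Qed.

(** For a natural number [z = n] this is the logarithm of [4^n (n!)^2 / (2n)!]. *)
Definition wallis_log (z : R) : R := 2 * lnPi z - lnPi (2 * z) + 2 * z * ln 2.

Lemma wallis_log_0 : wallis_log 0 = 0.
Proof.
unfold wallis_log; rewrite Rmult_0_r; unfold lnPi; rewrite Pi_fun_0, ln_1; ring.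
Qed.

Lemma wallis_log_succ (z : R) : 0 <= z ->
  wallis_log (z + 1) = wallis_log z + ln (2 * z + 2) - ln (2 * z + 1).
Proof.
intros Hz; unfold wallis_log.
replace (2 * (z + 1)) with (2 * z + 1 + 1) by ring.
rewrite !lnPi_succ by lra.
replace (2 * z + 2) with (2 * (z + 1)) by ring.
replace (2 * z + 1 + 1) with (2 * (z + 1)) by ring.
rewrite ln_mult by lra; ring.
Qed.

(** Both parities of the sine integrals are the same Wallis quotient, once inverted
    and once not; comparing neighbouring integrals therefore pins down its square. *)
Lemma sin_pow_integral_wallis (n : nat) :
  sin_pow_integral (2 * n) = PI / 2 * exp (- wallis_log (INR n)) /\
  (2 * INR n + 1) * sin_pow_integral (2 * n + 1) = exp (wallis_log (INR n)).
Proof.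
induction n as [| n [IH1 IH2]].
- simpl INR; rewrite wallis_log_0, Ropp_0, exp_0; split; unfold sin_pow_integral.
  + simpl; rewrite (RInt_const (V := R_CompleteNormedModule)).
    unfold scal; simpl; unfold mult; simpl; ring.
  + rewrite (is_RInt_unique (V := R_CompleteNormedModule) _ 0 (PI / 2)
      (minus (- cos (PI / 2)) (- cos 0))).
    * rewrite cos_PI2, cos_0; unfold minus, plus, opp; simpl; ring.
    * apply (is_RInt_derive (V := R_CompleteNormedModule) (fun t => - cos t)).
      -- intros t _; auto_derive; [easy | simpl; ring].
      -- intros t _; apply (ex_derive_continuous (V := R_NormedModule)).
         auto_derive; easy.
- assert (Hn := pos_INR n).
  rewrite S_INR, wallis_log_succ by easy.
  assert (R1 := sin_pow_integral_rec (2 * n)).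
  assert (R2 := sin_pow_integral_rec (2 * n + 1)).
  replace (S (S (2 * n))) with (2 * S n)%nat in R1 by lia.
  replace (S (S (2 * n + 1))) with (2 * S n + 1)%nat in R2 by lia.
  replace (INR (2 * S n)) with (2 * INR n + 2) in R1
    by (rewrite mult_INR, (S_INR n); simpl; ring).
  replace (INR (S (2 * n))) with (2 * INR n + 1) in R1
    by (rewrite S_INR, mult_INR; simpl; ring).
  replace (INR (2 * S n + 1)) with (2 * INR n + 3) in R2
    by (rewrite plus_INR, mult_INR, (S_INR n); simpl; ring).
  replace (INR (S (2 * n + 1))) with (2 * INR n + 2) in R2
    by (rewrite S_INR, plus_INR, mult_INR; simpl; ring).
  split.
  + replace (- (wallis_log (INR n) + ln (2 * INR n + 2) - ln (2 * INR n + 1)))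
      with (- wallis_log (INR n) + ln (2 * INR n + 1) + - ln (2 * INR n + 2))
      by ring.
    rewrite !exp_plus, exp_Ropp, !exp_ln by lra.
    rewrite exp_Ropp, exp_ln by lra.
    rewrite exp_Ropp in IH1; rewrite IH1 in R1.
    apply Rmult_eq_reg_l with (2 * INR n + 2); [| lra].
    rewrite R1; field; split; [lra | apply Rgt_not_eq, exp_pos].
  + replace (wallis_log (INR n) + ln (2 * INR n + 2) - ln (2 * INR n + 1))
      with (wallis_log (INR n) + ln (2 * INR n + 2) + - ln (2 * INR n + 1))
      by ring.
    rewrite !exp_plus, exp_Ropp, !exp_ln by lra.
    rewrite <- IH2.
    replace (2 * (INR n + 1) + 1) with (2 * INR n + 3) by ring.
    rewrite R2; field; lra.
Qed.

(** These bounds are [W(2n+2) <= W(2n+1) <= W(2n)], with [W] the sine integrals, in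
    logarithmic form.  They say that the square of the Wallis quotient is
    asymptotically [PI * n], which is how [PI] enters Stirling's constant. *)
Lemma wallis_log_bounds (n : nat) :
  ln (PI / 2) + 2 * ln (2 * INR n + 1) - ln (2 * INR n + 2)
    <= 2 * wallis_log (INR n)
    <= ln (PI / 2) + ln (2 * INR n + 1).
Proof.
destruct (sin_pow_integral_wallis n) as [H1 H2].
destruct (sin_pow_integral_wallis (S n)) as [H3 _].
assert (Hn := pos_INR n).
rewrite S_INR, wallis_log_succ in H3 by easy.
assert (D1 := sin_pow_integral_decr (2 * n)).
assert (D2 := sin_pow_integral_decr (2 * n + 1)).
replace (S (2 * n)) with (2 * n + 1)%nat in D1 by lia.
replace (S (2 * n + 1)) with (2 * S n)%nat in D2 by lia.
assert (Hpi : 0 < PI / 2) by (generalize PI_RGT_0; lra).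
set (q := wallis_log (INR n)) in *.
assert (H2' : sin_pow_integral (2 * n + 1) = exp (q - ln (2 * INR n + 1))).
{ unfold Rminus; rewrite exp_plus, exp_Ropp, exp_ln by lra.
  rewrite <- H2; field; lra. }
rewrite H1, H2' in D1; rewrite H3, H2' in D2.
rewrite <- (exp_ln (PI / 2)) in D1, D2 by easy.
rewrite <- exp_plus in D1, D2.
assert (Hle : forall u v, exp u <= exp v -> u <= v).
{ intros u v H; apply Rnot_lt_le; intros Hlt.
  apply exp_increasing in Hlt; lra. }
apply Hle in D1, D2; lra.
Qed.

(** * Stirling's formula for the interpolated factorial *)

Lemma ln_ratio_bounds (a b : R) : 0 < a -> 0 < b ->
  (b - a) / b <= ln b - ln a <= (b - a) / a.
Proof.
intros Ha Hb.
assert (H : forall u v, 0 < u -> 0 < v -> ln v - ln u <= (v - u) / u).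
{ intros u v Hu Hv.
  generalize (exp_ineq1_le (ln v - ln u)).
  unfold Rminus at 2; rewrite exp_plus, exp_Ropp, !exp_ln by easy.
  intros H; apply Rle_trans with (v * / u - 1); [lra |].
  apply Req_le; field; lra. }
split; [| now apply H].
generalize (H b a Hb Ha).
replace ((b - a) / b) with (- ((a - b) / b)) by (field; lra); lra.
Qed.

Lemma nonneg_of_derive_nonneg (f df : R -> R) (u : R) :
  0 <= u -> f 0 = 0 ->
  (forall t, 0 <= t -> is_derive f t (df t) /\ 0 <= df t) -> 0 <= f u.
Proof.
intros Hu H0 H.
destruct (MVT_gen f 0 u df) as (c & Hc & E).
- intros t Ht; apply H; rewrite Rmin_left in Ht by easy; lra.
- intros t Ht; apply derivable_continuous_pt; exists (df t).
  apply is_derive_Reals, H; rewrite Rmin_left in Ht by easy; lra.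
- rewrite Rmin_left in Hc by easy.
  destruct (H c) as [_ Hd]; [lra |].
  rewrite H0 in E; nra.
Qed.

(** Both bounds are equalities at 0, and the differences have the nonnegative
    derivatives [t^2 / ((1+t) (2+t)^2)] and [(t / (1+t))^2 / 2].  They are the midpoint
    and trapezoid estimates of the integral of [1 / t] over [[1, 1 + u]]. *)
Lemma ln_trapezoid_bounds (u : R) : 0 <= u ->
  2 * u / (2 + u) <= ln (1 + u) <= (1 + u) / 2 - 1 / (2 * (1 + u)).
Proof.
intros Hu; split.
- enough (0 <= ln (1 + u) - 2 * u / (2 + u)) by lra.
  apply (nonneg_of_derive_nonneg (fun u => ln (1 + u) - 2 * u / (2 + u))
    (fun t => t ^ 2 / ((1 + t) * (2 + t) ^ 2))); [easy | |].
  + rewrite Rplus_0_r, ln_1; field.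
  + intros t Ht; split.
    * auto_derive; [lra | field; lra].
    * apply Rmult_le_pos; [apply pow2_ge_0 |].
      apply Rlt_le, Rinv_0_lt_compat, Rmult_lt_0_compat; [lra |].
      apply pow_lt; lra.
- enough (0 <= (1 + u) / 2 - 1 / (2 * (1 + u)) - ln (1 + u)) by lra.
  apply (nonneg_of_derive_nonneg
    (fun u => (1 + u) / 2 - 1 / (2 * (1 + u)) - ln (1 + u))
    (fun t => (t / (1 + t)) ^ 2 / 2)); [easy | |].
  + rewrite Rplus_0_r, ln_1; field.
  + intros t Ht; split.
    * auto_derive; [lra | field; lra].
    * generalize (pow2_ge_0 (t / (1 + t))); lra.
Qed.

(** The logarithm of [Pi z] divided by [z^(z + 1/2) e^(-z)]; Stirling's formula says
    that its limit is [ln (2 * PI) / 2]. *)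
Definition stirling_error (z : R) : R := lnPi z - (z + 1 / 2) * ln z + z.

(** The decrement is [(z + 1/2) ln ((z+1)/z) - 1].  The midpoint and trapezoid
    bounds with [u = 1 / z] place it between 0 and a telescoping term, so that the
    error is decreasing and bounded below along [z + n]. *)
(** Write [y = k + l] with [k] natural and [0 <= l < 1], and compare with the natural
    numbers [n + k]. *)
Lemma stirling_error_succ (z : R) : 0 < z ->
  stirling_error z - (1 / (4 * z) - 1 / (4 * (z + 1)))
    <= stirling_error (z + 1) <= stirling_error z.
Proof.
intros Hz; unfold stirling_error.
rewrite lnPi_succ by lra.
assert (Hu : 0 < / z) by now apply Rinv_0_lt_compat.
destruct (ln_trapezoid_bounds (/ z)) as [H1 H2]; [lra |].
replace (1 + / z) with ((z + 1) / z) in H1, H2 by (field; lra).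
unfold Rdiv in H1 at 2; unfold Rdiv in H2 at 1.
rewrite ln_mult, ln_Rinv in H1, H2 by lra.
assert (E1 : (z + 1 / 2) * (2 * / z / (2 + / z)) = 1) by (field; lra).
assert (E2 : (z + 1 / 2) * ((z + 1) / z / 2 - 1 / (2 * ((z + 1) / z)))
  = 1 + (1 / (4 * z) - 1 / (4 * (z + 1)))) by (field; lra).
apply (Rmult_le_compat_l (z + 1 / 2)) in H1, H2; try lra.
Qed.

(** In this combination the powers of [z] in the errors cancel up to [ln z], so that
    the limit of the error can be read off from the Wallis quotient. *)
Lemma stirling_error_double (z : R) : 0 < z ->
  2 * (2 * stirling_error z - stirling_error (2 * z))
    = 2 * wallis_log z - ln z + ln 2.
Proof.
intros Hz; unfold stirling_error, wallis_log.
rewrite ln_mult by lra; field.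
Qed.

Lemma inv_INR_lim (c : R) (k : nat) :
  is_lim_seq (fun n => c / INR (n + S k)) 0.
Proof.
replace (Finite 0) with (Rbar_mult c 0) by (simpl; f_equal; ring).
apply is_lim_seq_scal_l.
apply (is_lim_seq_incr_n (fun n => / INR n) (S k)).
replace (Finite 0) with (Rbar_inv p_infty) by easy.
apply is_lim_seq_inv; [apply is_lim_seq_INR | easy].
Qed.

(** The limit exists by monotonicity.  Calling it [C], the combination
    [2 (2 E(n) - E(2n))] tends both to [2 C] and, by Wallis, to [ln (2 * PI)]. *)
Lemma stirling_nat : is_lim_seq (fun n => stirling_error (INR n)) (ln (2 * PI) / 2).
Proof.
apply is_lim_seq_incr_1.
destruct (ex_finite_lim_seq_decr (fun n => stirling_error (INR (S n)))
  (stirling_error 1 - 1 / 4)) as [C HC].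
{ intros n; rewrite (S_INR (S n)); apply stirling_error_succ.
  apply lt_0_INR; lia. }
{ intros n.
  enough (stirling_error 1 - 1 / 4
    <= stirling_error (INR (S n)) - 1 / (4 * INR (S n))).
  { assert (0 < 1 / (4 * INR (S n))); [| lra].
    apply Rdiv_lt_0_compat; [lra |].
    generalize (lt_0_INR (S n) (Nat.lt_0_succ n)); lra. }
  induction n as [| n IH].
  - simpl INR; lra.
  - rewrite (S_INR (S n)).
    generalize (stirling_error_succ (INR (S n))
      (lt_0_INR (S n) (Nat.lt_0_succ n))); lra. }
enough (C = ln (2 * PI) / 2) as <- by exact HC.
assert (H2 : is_lim_seq (fun n => stirling_error (INR (2 * S n))) C).
{ apply (is_lim_seq_subseq (fun n => stirling_error (INR n)) C
    (fun n => (2 * S n)%nat)).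
  - apply eventually_subseq; intros n; lia.
  - now apply is_lim_seq_incr_1. }
assert (H3 : is_lim_seq (fun n => 2 * (2 * stirling_error (INR (S n))
    - stirling_error (INR (2 * S n)))) (2 * (2 * C - C))).
{ apply (is_lim_seq_scal_l _ 2 (2 * C - C)).
  apply (is_lim_seq_minus' _ _ (2 * C) C); [| easy].
  now apply (is_lim_seq_scal_l _ 2 C). }
assert (H4 : is_lim_seq (fun n => 2 * (2 * stirling_error (INR (S n))
    - stirling_error (INR (2 * S n)))) (ln (2 * PI))).
{ apply is_lim_seq_le_le with (fun n => ln (2 * PI) + -1 / INR (n + 1))
    (fun n => ln (2 * PI) + 1 / INR (n + 1)).
  - intros n; rewrite Nat.add_1_r, mult_INR; simpl (INR 2).
    assert (Hz := lt_0_INR (S n) (Nat.lt_0_succ n)).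
    assert (HW := wallis_log_bounds (S n)).
    set (z := INR (S n)) in *.
    rewrite stirling_error_double by easy.
    assert (Hpi := PI_RGT_0).
    replace (ln (PI / 2)) with (ln PI - ln 2) in HW
      by (unfold Rdiv; rewrite ln_mult, ln_Rinv by lra; ring).
    replace (2 * z + 2) with (2 * (z + 1)) in HW by ring.
    rewrite ln_mult in HW by lra; rewrite (ln_mult 2 PI) by lra.
    assert (B1 := ln_ratio_bounds (2 * z) (2 * z + 1) ltac:(lra) ltac:(lra)).
    assert (B2 := ln_ratio_bounds z (z + 1) ltac:(lra) ltac:(lra)).
    rewrite (ln_mult 2 z) in B1 by lra.
    assert (E1 : (2 * z + 1 - 2 * z) / (2 * z) <= 1 / z).
    { replace ((2 * z + 1 - 2 * z) / (2 * z)) with (/ 2 * (1 / z)) by (field; lra).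
      assert (0 < 1 / z) by (apply Rdiv_lt_0_compat; lra); lra. }
    assert (E2 : 0 <= (2 * z + 1 - 2 * z) / (2 * z + 1)).
    { apply Rlt_le, Rdiv_lt_0_compat; lra. }
    replace ((z + 1 - z) / z) with (1 / z) in B2 by (field; lra).
    replace (-1 / z) with (- (1 / z)) by (field; lra).
    lra.
  - replace (Finite (ln (2 * PI))) with (Finite (ln (2 * PI) + 0)) by (f_equal; ring).
    apply is_lim_seq_plus'; [apply is_lim_seq_const | apply inv_INR_lim].
  - replace (Finite (ln (2 * PI))) with (Finite (ln (2 * PI) + 0)) by (f_equal; ring).
    apply is_lim_seq_plus'; [apply is_lim_seq_const | apply inv_INR_lim]. }
apply is_lim_seq_unique in H3, H4.
assert (H5 := eq_trans (eq_sym H3) H4); injection H5; lra.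
Qed.

(** The logarithm of [Pi (s + l) / (Pi s * (s + 1)^l)], which Wendel's inequality
    squeezes to 0 as [s] tends to infinity. *)
Definition wendel_defect (l s : R) : R := lnPi (s + l) - lnPi s - l * ln (s + 1).

Lemma wendel_defect_bounds (l s : R) : 0 <= s -> 0 <= l <= 1 ->
  - (1 / (s + 1)) <= wendel_defect l s <= 0.
Proof.
intros Hs Hl; unfold wendel_defect.
assert (H1 := lnPi_wendel_upper s l Hs Hl).
assert (H2 := lnPi_wendel_lower s l Hs Hl).
destruct (ln_ratio_bounds (s + 1) (s + l + 1)) as [H3 H4]; try lra.
assert (H5 : (s + l + 1 - (s + 1)) / (s + 1) <= 1 / (s + 1)).
{ apply Rmult_le_compat_r; [| lra].
  apply Rlt_le, Rinv_0_lt_compat; lra. }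
assert (H6 : 0 <= (s + l + 1 - (s + 1)) / (s + l + 1)).
{ apply Rmult_le_pos; [lra |].
  apply Rlt_le, Rinv_0_lt_compat; lra. }
split; [nra | lra].
Qed.

(** Moving the argument by at most 1 changes the error by O(1/z), which transfers
    Stirling's formula from the natural numbers to any translate of them. *)
Lemma stirling_error_shift (l z : R) : 0 < z -> 0 <= l <= 1 ->
  - (3 / z) <= stirling_error (z + l) - stirling_error z <= 3 / z.
Proof.
intros Hz Hl.
assert (W := wendel_defect_bounds l z ltac:(lra) Hl).
unfold wendel_defect in W; unfold stirling_error.
assert (B1 := ln_ratio_bounds z (z + l) Hz ltac:(lra)).
assert (B2 := ln_ratio_bounds (z + l) (z + 1) ltac:(lra) ltac:(lra)).
assert (Hi : 0 < / z) by now apply Rinv_0_lt_compat.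
assert (E0 : 1 / (z + 1) <= / z).
{ unfold Rdiv; rewrite Rmult_1_l; apply Rinv_le_contravar; lra. }
assert (Hi2 : 0 < / (z + l) <= / z).
{ split; [apply Rinv_0_lt_compat; lra | apply Rinv_le_contravar; lra]. }
assert (E1 : 0 <= ln (z + 1) - ln (z + l) <= / z).
{ split.
  - assert (ln (z + l) <= ln (z + 1)) by (apply ln_le; lra); lra.
  - apply Rle_trans with (1 := proj2 B2); unfold Rdiv; nra. }
assert (E2 : l - / z <= (z + 1 / 2) * (ln (z + l) - ln z) <= l + / z).
{ split.
  - apply Rle_trans with ((z + 1 / 2) * ((z + l - z) / (z + l))).
    + replace ((z + 1 / 2) * ((z + l - z) / (z + l)))
        with (l - (l * (l - 1 / 2)) * / (z + l)) by (field; lra).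
      assert (l * (l - 1 / 2) <= 1) by nra. nra.
    + apply Rmult_le_compat_l; lra.
  - apply Rle_trans with ((z + 1 / 2) * ((z + l - z) / z)).
    + apply Rmult_le_compat_l; lra.
    + replace ((z + 1 / 2) * ((z + l - z) / z))
        with (l + l / 2 * / z) by (field; lra).
      nra. }
assert (E3 : l * (ln (z + 1) - ln (z + l)) <= / z) by nra.
assert (E4 : 0 <= l * (ln (z + 1) - ln (z + l))) by nra.
replace (3 / z) with (/ z + / z + / z) by (field; lra).
split; lra.
Qed.

Lemma stirling (y : R) : 0 <= y ->
  is_lim_seq (fun n => stirling_error (y + INR n)) (ln (2 * PI) / 2).
Proof.
intros Hy.
destruct (nfloor_ex y Hy) as [k Hk].
apply (is_lim_seq_incr_1 (fun n => stirling_error (y + INR n))).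
assert (H := proj1 (is_lim_seq_incr_n _ (S k) _) stirling_nat).
apply is_lim_seq_le_le with
  (fun n => stirling_error (INR (n + S k)) + -3 / INR (n + S k))
  (fun n => stirling_error (INR (n + S k)) + 3 / INR (n + S k)).
- intros n.
  assert (Hz : 0 < INR (n + S k)) by (apply lt_0_INR; lia).
  assert (B := stirling_error_shift (y - INR k) (INR (n + S k)) Hz ltac:(lra)).
  replace (INR (n + S k) + (y - INR k)) with (y + INR (S n)) in B
    by (rewrite plus_INR, !S_INR; ring).
  replace (-3 / INR (n + S k)) with (- (3 / INR (n + S k)))
    by (field; lra).
  lra.
- rewrite <- (Rplus_0_r (ln (2 * PI) / 2)).
  apply is_lim_seq_plus'; [exact H | apply inv_INR_lim].
- rewrite <- (Rplus_0_r (ln (2 * PI) / 2)).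
  apply is_lim_seq_plus'; [exact H | apply inv_INR_lim].
Qed.

Lemma wendel_defect_lim (l s : R) : 0 <= s -> 0 <= l <= 1 ->
  is_lim_seq (fun n => wendel_defect l (s + INR n)) 0.
Proof.
intros Hs Hl.
apply is_lim_seq_le_le with (fun n => -1 / INR (n + 1)) (fun _ => 0).
- intros n; assert (Hn := pos_INR n).
  generalize (wendel_defect_bounds l (s + INR n) ltac:(lra) Hl).
  rewrite Nat.add_1_r, S_INR.
  assert (1 / (s + INR n + 1) <= 1 / (INR n + 1)).
  { apply Rmult_le_compat_l; [lra |]; apply Rinv_le_contravar; lra. }
  replace (-1 / (INR n + 1)) with (- (1 / (INR n + 1))) by (field; lra).
  lra.
- apply inv_INR_lim.
- apply is_lim_seq_const.
Qed.

(** * Integration over unit blocks and up to infinity *)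

Lemma is_RInt_eq (f : R -> R) (a b l l' : R) :
  is_RInt f a b l -> l = l' -> is_RInt f a b l'.
Proof. now intros H <-. Qed.

Lemma is_RInt_cat (f : R -> R) (a b c l1 l2 l : R) :
  is_RInt f a b l1 -> is_RInt f b c l2 -> l1 + l2 = l -> is_RInt f a c l.
Proof. intros H1 H2 <-; exact (is_RInt_Chasles f a b c l1 l2 H1 H2). Qed.

(** On each unit interval all the integrands in play have this shape, up to
    splitting the interval once for [phi]. *)
Lemma is_RInt_affine_over (p q y u v : R) : 0 < y + u -> 0 < y + v ->
  is_RInt (fun t => (p + q * t) / (y + t)) u v
    (q * (v - u) + (p - q * y) * (ln (y + v) - ln (y + u))).
Proof.
intros Hu Hv.
assert (Hpos : forall t, Rmin u v <= t -> 0 < y + t).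
{ intros t Ht; assert (- y < Rmin u v) by (apply Rmin_glb_lt; lra); lra. }
replace (q * (v - u) + (p - q * y) * (ln (y + v) - ln (y + u))) with
  (minus (q * v + (p - q * y) * ln (y + v)) (q * u + (p - q * y) * ln (y + u)))
  by (unfold minus, plus, opp; simpl; ring).
apply (is_RInt_derive (V := R_CompleteNormedModule)
  (fun t => q * t + (p - q * y) * ln (y + t))).
- intros t Ht; specialize (Hpos t (proj1 Ht)).
  auto_derive; [easy | field; lra].
- intros t Ht; specialize (Hpos t (proj1 Ht)).
  apply (ex_derive_continuous (V := R_NormedModule)); auto_derive; lra.
Qed.

(** The integrand only has to agree with its formula in the open block, where the
    integer part is constant; the jumps sit at the end points. *)
Lemma is_RInt_unit_block (f : R -> R) (m : Z) (p q y u v : R) :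
  0 < y + u -> IZR m <= u <= v -> v <= IZR m + 1 ->
  (forall t, u < t < v -> IZR m = floor_R t -> f t = (p + q * t) / (y + t)) ->
  is_RInt f u v (q * (v - u) + (p - q * y) * (ln (y + v) - ln (y + u))).
Proof.
intros Hy Hu Hv Hf.
apply is_RInt_ext with (2 := is_RInt_affine_over p q y u v Hy ltac:(lra)).
intros t Ht; rewrite Rmin_left, Rmax_right in Ht by lra; symmetry.
apply Hf; [easy |]; unfold floor_R; f_equal; apply Int_part_spec; lra.
Qed.

(** A bounded interval meets finitely many unit blocks: induction on a bound for
    its length peels off the first block. *)
Lemma ex_RInt_of_unit_blocks (f : R -> R) (lo : R) :
  (forall (m : Z) u v, lo < u -> IZR m <= u <= v -> v <= IZR m + 1 ->
    ex_RInt f u v) ->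
  forall u v, lo < u -> lo < v -> ex_RInt f u v.
Proof.
intros Hf.
assert (H : forall (n : nat) u v, lo < u <= v -> v <= u + INR n -> ex_RInt f u v).
{ induction n as [| n IH]; intros u v Hu Hv.
  - simpl in Hv; replace v with u by lra; apply ex_RInt_point.
  - rewrite S_INR in Hv.
    assert (Hm := base_Int_part u); set (m := Int_part u) in *.
    destruct (Rle_lt_dec v (IZR m + 1)) as [Hv' | Hv'].
    { apply (Hf m); lra. }
    apply ex_RInt_Chasles with (IZR m + 1); [apply (Hf m); lra |].
    (* Starting at an integer, [n] blocks may fall short of [v]; the part beyond
       them lies in the single block after these. *)
    destruct (Rle_lt_dec v (IZR m + 1 + INR n)) as [Hn | Hn].
    { apply IH; lra. }
    apply ex_RInt_Chasles with (IZR m + 1 + INR n).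
    { apply IH; generalize (pos_INR n); lra. }
    apply (Hf (m + 1 + Z.of_nat n)%Z); rewrite ?plus_IZR, <- ?INR_IZR_INZ;
      generalize (pos_INR n); lra. }
assert (H' : forall u v, lo < u <= v -> ex_RInt f u v).
{ intros u v Hu; destruct (nfloor_ex (v - u)) as [n Hn]; [lra |].
  apply (H (S n)); [easy | rewrite S_INR; lra]. }
intros u v Hu Hv; destruct (Rle_lt_dec u v) as [Huv | Huv].
- now apply H'.
- apply ex_RInt_swap, H'; lra.
Qed.

(** Between a natural number [N] and the next one the integral is at most [1 / N] in
    absolute value, so the limit along the natural numbers is the limit along the
    reals. *)
Lemma is_RInt_to_infty_of_nat (f : R -> R) (a l : R) : a <= 1 ->
  (forall n : nat, ex_RInt f a (INR (S n))) ->
  (forall t, 1 <= t -> Rabs (f t) <= 1 / t) ->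
  is_lim_seq (fun n => RInt f a (INR (S n))) l ->
  is_RInt_gen f (at_point a) (Rbar_locally p_infty) l.
Proof.
intros Ha Hex Hb Hlim P [eps HP].
assert (He := cond_pos eps).
assert (He2 : 0 < eps / 2) by lra.
apply is_lim_seq_spec in Hlim.
destruct (Hlim (mkposreal (eps / 2) He2)) as [N HN]; simpl pos in HN.
assert (Hie : 0 < 2 / eps) by (apply Rdiv_lt_0_compat; lra).
apply Filter_prod with (fun b => b = a) (fun T => INR N + 3 + 2 / eps < T).
- reflexivity.
- now exists (INR N + 3 + 2 / eps).
- intros b T -> HT; simpl.
  assert (HN0 := pos_INR N).
  destruct (nfloor_ex T) as [[| n] Hn]; [lra | simpl in Hn; lra |].
  assert (HnT : ex_RInt f (INR (S n)) T).
  { apply (ex_RInt_Chasles_1 (V := R_CompleteNormedModule)) with (INR (S (S n)));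
      [rewrite (S_INR (S n)); lra |].
    apply ex_RInt_Chasles with a; [apply ex_RInt_swap |]; apply Hex. }
  exists (RInt f a T); split.
  { apply (RInt_correct (V := R_CompleteNormedModule)).
    apply ex_RInt_Chasles with (INR (S n)); [apply Hex | easy]. }
  apply HP.
  rewrite <- (RInt_Chasles (V := R_CompleteNormedModule) f a (INR (S n)) T)
    by easy.
  assert (H1 : Rabs (RInt f a (INR (S n)) - l) < eps / 2).
  { apply HN, INR_le; rewrite S_INR in Hn; lra. }
  assert (Hbig : 2 / eps < INR (S n)) by lra.
  assert (Hone : 1 <= INR (S n)) by (rewrite S_INR; generalize (pos_INR n); lra).
  assert (H2 : Rabs (RInt f (INR (S n)) T) <= (T - INR (S n)) * (1 / INR (S n))).
  { apply abs_RInt_le_const; [lra | easy |].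
    intros t Ht; apply Rle_trans with (1 / t); [apply Hb; lra |].
    apply Rmult_le_compat_l; [lra |]; apply Rinv_le_contravar; lra. }
  assert (H3 : 1 / INR (S n) <= eps / 2).
  { replace (eps / 2) with (1 / (2 / eps)) by (field; lra).
    apply Rmult_le_compat_l; [lra |]; apply Rinv_le_contravar; lra. }
  assert (H4 : (T - INR (S n)) * (1 / INR (S n)) <= 1 * (eps / 2)).
  { apply Rmult_le_compat; try lra.
    apply Rlt_le, Rdiv_lt_0_compat; lra. }
  change (Rabs (RInt f a (INR (S n)) + RInt f (INR (S n)) T - l) < eps).
  replace (RInt f a (INR (S n)) + RInt f (INR (S n)) T - l) with
    ((RInt f a (INR (S n)) - l) + RInt f (INR (S n)) T) by ring.
  apply Rle_lt_trans with (1 := Rabs_triang _ _); lra.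
Qed.

(** * Closed forms of the integrals *)

(** The function [phi] is [1 - alpha] on the first part of the block, of length
    [alpha], and [- alpha] on the rest. *)
Lemma phi_integrand_block (x alpha : R) (n : nat) :
  0 <= x -> 0 <= alpha <= 1 ->
  is_RInt (phi_integrand x alpha) (INR (S n)) (INR (S (S n)))
    (ln (x + INR (S n) + alpha) - (1 - alpha) * ln (x + INR (S n))
     - alpha * ln (x + INR (S n) + 1)).
Proof.
intros Hx Ha.
rewrite (S_INR (S n)).
assert (Hn : 0 < INR (S n)) by (apply lt_0_INR; lia).
assert (Hm : IZR (Z.of_nat (S n)) = INR (S n)) by (symmetry; apply INR_IZR_INZ).
set (m := INR (S n)) in *.
assert (H : forall p u v, m <= u <= v -> v <= m + 1 ->
  (forall t, u < t < v -> phi alpha t = p) ->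
  is_RInt (phi_integrand x alpha) u v
    (0 * (v - u) + (p - 0 * x) * (ln (x + v) - ln (x + u)))).
{ intros p u v Hu Hv Hp.
  apply (is_RInt_unit_block _ (Z.of_nat (S n))); rewrite ?Hm; try lra.
  intros t Ht _; unfold phi_integrand; rewrite (Hp t Ht); f_equal; ring. }
assert (Hfr : forall t, m < t < m + 1 -> frac_part t = t - m).
{ intros t Ht; unfold frac_part; rewrite <- (Int_part_spec t (Z.of_nat (S n)));
    rewrite Hm; lra. }
assert (Hlo : forall t, m < t < m + alpha -> phi alpha t = 1 - alpha).
{ intros t Ht; unfold phi; rewrite Hfr by lra.
  destruct (Rle_dec (t - m) alpha); lra. }
assert (Hhi : forall t, m + alpha < t < m + 1 -> phi alpha t = - alpha).
{ intros t Ht; unfold phi; rewrite Hfr by lra.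
  destruct (Rle_dec (t - m) alpha); lra. }
apply is_RInt_cat with (1 := H _ m (m + alpha) ltac:(lra) ltac:(lra) Hlo)
  (2 := H _ (m + alpha) (m + 1) ltac:(lra) ltac:(lra) Hhi).
rewrite <- !(Rplus_assoc x m); ring.
Qed.

(** The block integrals telescope through the functional equation of Pi: the step
    of [wendel_defect alpha (x + n)] in [n] is exactly one block. *)
Lemma is_RInt_phi_integrand (x alpha : R) (n : nat) :
  0 <= x -> 0 <= alpha <= 1 ->
  is_RInt (phi_integrand x alpha) 1 (INR (S n))
    (wendel_defect alpha (x + INR n)
     + (lnPi x - lnPi (x + alpha) + alpha * ln (x + 1))).
Proof.
intros Hx Ha; induction n as [| n IH].
- replace (wendel_defect alpha (x + INR 0)
    + (lnPi x - lnPi (x + alpha) + alpha * ln (x + 1))) with 0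
    by (unfold wendel_defect; simpl INR; rewrite Rplus_0_r; ring).
  apply (is_RInt_point (V := R_NormedModule)).
- apply is_RInt_cat with (1 := IH) (2 := phi_integrand_block x alpha n Hx Ha).
  assert (Hn := pos_INR n).
  unfold wendel_defect; rewrite S_INR.
  replace (x + (INR n + 1) + alpha) with (x + INR n + alpha + 1) by ring.
  rewrite <- (Rplus_assoc x (INR n) 1), !lnPi_succ by lra.
  ring.
Qed.

Lemma saw_integrand_block (x alpha : R) (m : Z) (u v : R) :
  0 < x + alpha + u -> IZR m <= u <= v -> v <= IZR m + 1 ->
  is_RInt (saw_integrand x alpha) u v
    (- (v - u) + (x + alpha + IZR m + 1 / 2)
      * (ln (x + alpha + v) - ln (x + alpha + u))).
Proof.
intros Hy Hu Hv.
replace (- (v - u) + (x + alpha + IZR m + 1 / 2)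
    * (ln (x + alpha + v) - ln (x + alpha + u)))
  with (- (1) * (v - u) + (1 / 2 + IZR m - - (1) * (x + alpha))
    * (ln (x + alpha + v) - ln (x + alpha + u))) by ring.
apply (is_RInt_unit_block _ m); try easy.
intros t Ht Hfl; unfold saw_integrand.
replace (frac_part t) with (t - IZR m)
  by (unfold frac_part; unfold floor_R in Hfl; lra).
f_equal; ring.
Qed.

(** The block integrals are the decrements of [stirling_error] along [x + alpha + n];
    the starting half block, from 1/2 to 1, fixes the constant. *)
Lemma is_RInt_saw_integrand (x alpha : R) (n : nat) :
  0 <= x + alpha ->
  is_RInt (saw_integrand x alpha) (1 / 2) (INR (S n))
    (lnPi (x + alpha) + (x + alpha) + 1 / 2
     - (x + alpha + 1 / 2) * ln (x + alpha + 1 / 2)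
     - stirling_error (x + alpha + INR (S n))).
Proof.
intros Hy; induction n as [| n IH].
- eapply is_RInt_eq.
  + apply (saw_integrand_block x alpha 0 (1 / 2) (INR 1)); simpl; lra.
  + unfold stirling_error; simpl; rewrite lnPi_succ by easy; field.
- assert (HS := S_INR (S n)).
  assert (Hn : 0 < INR (S n)) by (apply lt_0_INR; lia).
  assert (Hm : IZR (Z.of_nat (S n)) = INR (S n)) by (symmetry; apply INR_IZR_INZ).
  assert (B := saw_integrand_block x alpha (Z.of_nat (S n)) (INR (S n))
    (INR (S (S n))) ltac:(lra) ltac:(lra) ltac:(lra)).
  apply is_RInt_cat with (1 := IH) (2 := B).
  rewrite Hm, HS; set (m := INR (S n)) in *.
  unfold stirling_error.
  rewrite <- (Rplus_assoc (x + alpha) m 1), lnPi_succ by lra.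
  field.
Qed.

Lemma phi_to_infty (x alpha : R) : 0 <= x -> 0 <= alpha <= 1 ->
  is_RInt_gen (phi_integrand x alpha) (at_point 1) (Rbar_locally p_infty)
    (lnPi x - lnPi (x + alpha) + alpha * ln (x + 1)).
Proof.
intros Hx Ha.
apply is_RInt_to_infty_of_nat.
- apply Rle_refl.
- intros n; eexists; now apply is_RInt_phi_integrand.
- intros t Ht; unfold phi_integrand; rewrite Rabs_div by lra.
  rewrite (Rabs_pos_eq (x + t)) by lra.
  apply Rmult_le_compat; [apply Rabs_pos | | |].
  + apply Rlt_le, Rinv_0_lt_compat; lra.
  + unfold phi; destruct (Rle_dec _ _); apply Rabs_le; lra.
  + apply Rinv_le_contravar; lra.
- apply is_lim_seq_ext with (fun n => wendel_defect alpha (x + INR n)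
    + (lnPi x - lnPi (x + alpha) + alpha * ln (x + 1))).
  { intros n; symmetry; apply (is_RInt_unique (V := R_CompleteNormedModule)).
    now apply is_RInt_phi_integrand. }
  rewrite <- (Rplus_0_l (lnPi x - _ + _)) at 1.
  apply is_lim_seq_plus'; [now apply wendel_defect_lim | apply is_lim_seq_const].
Qed.

Lemma saw_to_infty (x alpha : R) : 0 <= x + alpha ->
  is_RInt_gen (saw_integrand x alpha) (at_point (1 / 2)) (Rbar_locally p_infty)
    (lnPi (x + alpha) + (x + alpha) + 1 / 2
     - (x + alpha + 1 / 2) * ln (x + alpha + 1 / 2) - ln (2 * PI) / 2).
Proof.
intros Hy.
apply is_RInt_to_infty_of_nat.
- lra.
- intros n; eexists; now apply is_RInt_saw_integrand.
- intros t Ht; unfold saw_integrand; rewrite Rabs_div by lra.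
  rewrite (Rabs_pos_eq (x + alpha + t)) by lra.
  apply Rmult_le_compat; [apply Rabs_pos | | |].
  + apply Rlt_le, Rinv_0_lt_compat; lra.
  + apply Rabs_le; generalize (base_fp t); lra.
  + apply Rinv_le_contravar; lra.
- apply is_lim_seq_ext with (fun n => lnPi (x + alpha) + (x + alpha) + 1 / 2
     - (x + alpha + 1 / 2) * ln (x + alpha + 1 / 2)
     - stirling_error (x + alpha + INR (S n))).
  { intros n; symmetry; apply (is_RInt_unique (V := R_CompleteNormedModule)).
    now apply is_RInt_saw_integrand. }
  apply is_lim_seq_minus'; [apply is_lim_seq_const |].
  apply (is_lim_seq_incr_1 (fun n => stirling_error (x + alpha + INR n))).
  now apply stirling.
Qed.

Lemma saw_ex_RInt (x alpha u v : R) :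
  0 < x + alpha + u -> 0 < x + alpha + v -> ex_RInt (saw_integrand x alpha) u v.
Proof.
intros Hu Hv; apply ex_RInt_of_unit_blocks with (- (x + alpha)); try lra.
intros m a b Ha Hab Hb; eexists; apply (saw_integrand_block x alpha m); lra.
Qed.

Lemma is_RInt_shift_integrand (x alpha u v : R) :
  0 < x + alpha + u -> 0 < x + alpha + v ->
  is_RInt (shift_integrand x alpha) u v
    (v - u - (x + alpha + 1 / 2) * (ln (x + alpha + v) - ln (x + alpha + u))).
Proof.
intros Hu Hv.
replace (v - u - (x + alpha + 1 / 2) * (ln (x + alpha + v) - ln (x + alpha + u)))
  with (1 * (v - u) + (- (1 / 2) - 1 * (x + alpha))
    * (ln (x + alpha + v) - ln (x + alpha + u))) by ring.
apply is_RInt_ext with (2 := is_RInt_affine_over _ _ _ _ _ Hu Hv).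
intros t _; unfold shift_integrand; f_equal; ring.
Qed.

(** The identity [(1/2 - frac t) + (t - 1/2) = floor t], divided by [x + alpha + t]. *)
Lemma is_RInt_floor_integrand (x alpha u v : R) :
  0 < x + alpha + u -> 0 < x + alpha + v ->
  is_RInt (floor_integrand x alpha) u v
    (RInt (saw_integrand x alpha) u v + RInt (shift_integrand x alpha) u v).
Proof.
intros Hu Hv.
apply is_RInt_ext with (fun t => plus (saw_integrand x alpha t)
  (shift_integrand x alpha t)).
- intros t _; unfold plus, saw_integrand, shift_integrand, floor_integrand; simpl.
  unfold frac_part, floor_R, Rdiv; ring.
- apply (is_RInt_plus (V := R_NormedModule));
    apply (RInt_correct (V := R_CompleteNormedModule)).
  + now apply saw_ex_RInt.
  + eexists; now apply is_RInt_shift_integrand.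
Qed.

(** Here [x + alpha + t] may vanish at an end point, as the end points do not matter.
    This covers [x = alpha = c = 0]. *)
Lemma is_RInt_floor_integrand_0 (x alpha u v : R) : 0 <= u <= 1 -> 0 <= v <= 1 ->
  is_RInt (floor_integrand x alpha) u v 0.
Proof.
intros Hu Hv.
apply is_RInt_ext with (fun _ => 0).
- intros t Ht; unfold floor_integrand, floor_R.
  assert (0 <= Rmin u v) by (apply Rmin_glb; lra).
  assert (Rmax u v <= 1) by (apply Rmax_lub; lra).
  rewrite <- (Int_part_spec t 0) by (simpl; lra).
  symmetry; apply Rmult_0_l.
- eapply is_RInt_eq.
  + apply (is_RInt_const (V := R_NormedModule)).
  + unfold scal; simpl; unfold mult; simpl; ring.
Qed.

Lemma Pi_hat_exp (x alpha : R) : 0 <= x ->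
  Pi_hat x alpha = exp (lnPi x + alpha * ln (x + 1)).
Proof.
intros Hx; unfold Pi_hat, Rpower; rewrite <- exp_plus; f_equal.
change (ln (Pi_fun (x + 1))) with (lnPi (x + 1)); rewrite lnPi_succ by easy.
unfold lnPi; ring.
Qed.

Lemma S_shift_exp (d y : R) :
  S_shift d y = exp (ln (2 * PI) / 2 - d + (y + 1 / 2) * ln (y + d) - y).
Proof.
unfold S_shift; rewrite <- Rpower_sqrt by (generalize PI_RGT_0; lra).
unfold Rpower; rewrite <- !exp_plus; f_equal; unfold Rdiv; ring.
Qed.

(** * The quotient of the interpolated factorial by Stirling's function *)

(** The lower limit is moved from 1/2 to [d] by adding the integral over a bounded
    interval; the total is kept in terms of integrals because only the sum with the
    floor integral matters. *)
Lemma saw_to_infty_shift (x alpha d : R) :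
  0 <= x + alpha -> 0 < x + alpha + d ->
  is_RInt_gen (saw_integrand x alpha) (at_point d) (Rbar_locally p_infty)
    (RInt_to_infty (saw_integrand x alpha) (1 / 2)
     - RInt (saw_integrand x alpha) (1 / 2) d).
Proof.
intros Hy Hd.
assert (Hs : ex_RInt (saw_integrand x alpha) (1 / 2) d)
  by (apply saw_ex_RInt; lra).
assert (H := saw_to_infty x alpha Hy).
unfold RInt_to_infty.
rewrite (is_RInt_gen_unique (V := R_CompleteNormedModule) _ _ H).
set (l := _ - ln (2 * PI) / 2) in *.
replace (l - RInt (saw_integrand x alpha) (1 / 2) d)
  with (plus (opp (RInt (saw_integrand x alpha) (1 / 2) d)) l)
  by (unfold plus, opp; simpl; ring).
apply (is_RInt_gen_Chasles (V := R_NormedModule)) with (1 / 2); [| exact H].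
apply is_RInt_gen_at_point, (is_RInt_swap (V := R_NormedModule)).
now apply (RInt_correct (V := R_CompleteNormedModule)).
Qed.

(** Adding the three closed forms, [lnPi (x + alpha)] cancels between the first two
    and the logarithm of [x + alpha + 1/2] between the last two. *)
Lemma Pi_hat_ratio (d x alpha : R) :
  0 <= x -> 0 <= alpha <= 1 -> 0 < x + alpha + d ->
  Pi_hat x alpha / S_shift d (x + alpha)
  = exp (RInt_to_infty (phi_integrand x alpha) 1
         + RInt_to_infty (saw_integrand x alpha) (1 / 2)
         + RInt (shift_integrand x alpha) (1 / 2) d).
Proof.
intros Hx Ha Hd.
assert (Hy : 0 <= x + alpha) by lra.
assert (H1 : RInt_to_infty (phi_integrand x alpha) 1 = _)
  by exact (is_RInt_gen_unique (V := R_CompleteNormedModule) _ _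
    (phi_to_infty x alpha Hx Ha)).
assert (H2 : RInt_to_infty (saw_integrand x alpha) (1 / 2) = _)
  by exact (is_RInt_gen_unique (V := R_CompleteNormedModule) _ _
    (saw_to_infty x alpha Hy)).
assert (H3 : RInt (shift_integrand x alpha) (1 / 2) d = _)
  by exact (is_RInt_unique (V := R_CompleteNormedModule) _ _ _ _
    (is_RInt_shift_integrand x alpha (1 / 2) d ltac:(lra) Hd)).
rewrite Pi_hat_exp, S_shift_exp by easy.
unfold Rdiv at 1; rewrite <- exp_Ropp, <- exp_plus; f_equal; lra.
Qed.

(** The part of the integral from [c] to 1/2 is 0, which is why the starting point
    [c] in the unit interval is arbitrary. *)
Lemma is_RInt_floor_from_unit (c d x alpha : R) :
  0 <= x + alpha -> 0 < x + alpha + d -> 0 <= c <= 1 ->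
  is_RInt (floor_integrand x alpha) c d
    (RInt (saw_integrand x alpha) (1 / 2) d
     + RInt (shift_integrand x alpha) (1 / 2) d).
Proof.
intros Hy Hd Hc.
apply is_RInt_cat with
  (1 := is_RInt_floor_integrand_0 x alpha c (1 / 2) Hc ltac:(lra))
  (2 := is_RInt_floor_integrand x alpha (1 / 2) d ltac:(lra) Hd).
ring.
Qed.

Theorem theorem15 :
  (forall d x alpha c : R,
     0 <= x -> 0 <= alpha <= 1 -> x + alpha > - d -> 0 <= c <= 1 ->
     ex_RInt_to_infty (phi_integrand x alpha) 1 /\
     ex_RInt_to_infty (saw_integrand x alpha) (1 / 2) /\
     ex_RInt (shift_integrand x alpha) (1 / 2) d /\
     ex_RInt_to_infty (saw_integrand x alpha) d /\
     ex_RInt (floor_integrand x alpha) c d /\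
     Pi_hat x alpha / S_shift d (x + alpha)
     = exp (RInt_to_infty (phi_integrand x alpha) 1
            + RInt_to_infty (saw_integrand x alpha) (1 / 2)
            + RInt (shift_integrand x alpha) (1 / 2) d) /\
     exp (RInt_to_infty (phi_integrand x alpha) 1
          + RInt_to_infty (saw_integrand x alpha) (1 / 2)
          + RInt (shift_integrand x alpha) (1 / 2) d)
     = exp (RInt_to_infty (phi_integrand x alpha) 1
            + RInt_to_infty (saw_integrand x alpha) d
            + RInt (floor_integrand x alpha) c d)) /\
  (forall d x alpha : R,
     0 <= d <= 1 -> 0 <= x -> 0 <= alpha <= 1 -> x + alpha > - d ->
     ex_RInt_to_infty (phi_integrand x alpha) 1 /\
     ex_RInt_to_infty (saw_integrand x alpha) d /\
     Pi_hat x alpha / S_shift d (x + alpha)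
     = exp (RInt_to_infty (phi_integrand x alpha) 1
            + RInt_to_infty (saw_integrand x alpha) d)).
Proof.
assert (Hfull : forall d x alpha c : R,
  0 <= x -> 0 <= alpha <= 1 -> x + alpha > - d -> 0 <= c <= 1 ->
  RInt_to_infty (saw_integrand x alpha) (1 / 2)
    + RInt (shift_integrand x alpha) (1 / 2) d
  = RInt_to_infty (saw_integrand x alpha) d
    + RInt (floor_integrand x alpha) c d).
{ intros d x alpha c Hx Ha Hd Hc.
  assert (Hy : 0 <= x + alpha) by lra.
  assert (Hyd : 0 < x + alpha + d) by lra.
  assert (H1 : RInt (floor_integrand x alpha) c d = _)
    by exact (is_RInt_unique (V := R_CompleteNormedModule) _ _ _ _
      (is_RInt_floor_from_unit c d x alpha Hy Hyd Hc)).
  assert (H2 : RInt_to_infty (saw_integrand x alpha) d = _)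
    by exact (is_RInt_gen_unique (V := R_CompleteNormedModule) _ _
      (saw_to_infty_shift x alpha d Hy Hyd)).
  lra. }
split.
- intros d x alpha c Hx Ha Hd Hc.
  repeat split.
  + eexists; now apply phi_to_infty.
  + eexists; apply saw_to_infty; lra.
  + eexists; apply is_RInt_shift_integrand; lra.
  + eexists; apply saw_to_infty_shift; lra.
  + eexists; apply is_RInt_floor_from_unit; lra.
  + apply Pi_hat_ratio; lra.
  + f_equal; generalize (Hfull d x alpha c Hx Ha Hd Hc); lra.
- intros d x alpha Hd Hx Ha Hy.
  repeat split.
  + eexists; now apply phi_to_infty.
  + eexists; apply saw_to_infty_shift; lra.
  + rewrite Pi_hat_ratio by lra; f_equal.
    generalize (Hfull d x alpha d Hx Ha Hy Hd).
    (* With [c = d] the floor integral is over a single point. *)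
    rewrite (RInt_point (V := R_CompleteNormedModule)).
    unfold zero; simpl; lra.
Qed.
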